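(* If $l$ is an even positive integer, then there is no $l$-reflexive polygon.
   Context: Let $N\cong\mathbb{Z}^2$ be a lattice with dual lattice $M=\mathrm{Hom}(N,\mathbb{Z})$. A polygon here is a 2-dimensional convex lattice polytope $P\subset N\otimes_{\mathbb{Z}}\mathbb{Q}$, i.e. its vertices lie in $N$. A nonzero lattice point $x$ is primitive if the segment from $\mathbf{0}$ to $x$ contains no lattice points other than its endpoints. If $P$ has the origin in its interior and $F$ is a facet (edge) of $P$, the primitive outer normal of $F$ is the unique primitive $u_F\in M$ such that $F=\{x\in P\mid\langle u_F,x\rangle=l_F\}$ for some positive integer $l_F$, called the local index of $F$. $P$ is $l$-reflexive if it contains the origin in its interior, all its vertices are primitive, and $l_F=l$ for every facet $F$. *)

(* Defs.v *)
From HB Require Import structures.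
From mathcomp Require Import all_boot all_order all_algebra.
From mathcomp Require Import all_classical all_reals topology normedtype.

Set Implicit Arguments.
Unset Strict Implicit.
Unset Printing Implicit Defensive.

Import Order.TTheory GRing.Theory Num.Theory.
Import numFieldTopology.Exports numFieldNormedType.Exports.

Local Open Scope classical_set_scope.
Local Open Scope ring_scope.

(* Conventions: N = Z^n is 'rV[int]_n, its dual M = Hom(N, Z) is 'cV[int]_n    *)
(* (a column acts on rows by matrix multiplication), and the rational          *)
(* extensions of N and M are 'rV[rat]_n and 'cV[rat]_n.                        *)

Definition lat_emb (m n : nat) (x : 'M[int]_(m, n)) : 'M[rat]_(m, n) :=
  map_mx intr x.

Definition pairing (n : nat) (u : 'cV[rat]_n) (x : 'rV[rat]_n) : rat :=
  (x *m u) 0 0.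

(* Stated for arbitrary shapes, so as to cover both N and M.                   *)
Definition primitive (m n : nat) (x : 'M[int]_(m, n)) : Prop :=
  x != 0 /\
  forall y : 'M[int]_(m, n),
    (exists t : rat, 0 <= t <= 1 /\ lat_emb y = t *: lat_emb x) ->
    y = 0 \/ y = x.

Definition conv_hull (n : nat) (s : seq 'rV[rat]_n) : set 'rV[rat]_n :=
  [set x | exists a : 'I_(size s) -> rat,
    [/\ forall i, 0 <= a i, \sum_i a i = 1 & x = \sum_i a i *: s`_i]].

Definition polytope (n : nat) (P : set 'rV[rat]_n) : Prop :=
  exists s : seq 'rV[rat]_n, P = conv_hull s.

Definition aff_indep (n : nat) (s : seq 'rV[rat]_n) : bool :=
  if s is x :: s' then free [seq y - x | y <- s'] else true.

(* The affine hull of A has dimension d: A contains d+1, but not d+2, affinely *)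
(* independent points.                                                         *)
Definition has_dim (n : nat) (A : set 'rV[rat]_n) (d : nat) : Prop :=
  (exists p : d.+1.-tuple 'rV[rat]_n,
      (forall i, A (tnth p i)) /\ aff_indep p) /\
  ~ (exists p : d.+2.-tuple 'rV[rat]_n,
      (forall i, A (tnth p i)) /\ aff_indep p).

Definition face (n : nat) (P F : set 'rV[rat]_n) : Prop :=
  exists (u : 'cV[rat]_n) (c : rat),
    (forall x, P x -> pairing u x <= c) /\
    F = [set x | P x /\ pairing u x = c].

Definition vertex (n : nat) (P : set 'rV[rat]_n) (v : 'rV[rat]_n) : Prop :=
  face P [set v].

Definition facet (n : nat) (P F : set 'rV[rat]_n) : Prop :=
  exists d : nat, [/\ has_dim P d.+1, face P F & has_dim F d].

Definition lattice_polygon (P : set 'rV[rat]_2) : Prop :=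
  [/\ polytope P, has_dim P 2 &
      forall v, vertex P v -> exists x : 'rV[int]_2, v = lat_emb x].

(* The topology of rat, seen as a numFieldType, is carried by its alias rat^o. *)
Definition origin_in_interior (n : nat) (P : set 'rV[rat]_n) : Prop :=
  ((P : set 'rV[rat^o]_n)°) 0.

Definition primitive_outer_normal (n : nat) (P F : set 'rV[rat]_n)
    (u : 'cV[int]_n) (k : nat) : Prop :=
  [/\ primitive u, (0 < k)%N &
      F = [set x | P x /\ pairing (lat_emb u) x = k%:R]].

(* For P a lattice polytope with 0 in its interior and F a facet, just one pair *)
(* (u, k) satisfies primitive_outer_normal P F u k; k is the local index of F. *)
Definition has_local_index (n : nat) (P F : set 'rV[rat]_n) (k : nat) : Prop :=
  exists u : 'cV[int]_n, primitive_outer_normal P F u k.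

Definition reflexive_polygon (l : nat) (P : set 'rV[rat]_2) : Prop :=
  [/\ lattice_polygon P,
      origin_in_interior P,
      forall x : 'rV[int]_2, vertex P (lat_emb x) -> primitive x &
      forall F, facet P F -> has_local_index P F l].

(* Main.v *)
(* Let u be primitive with <u,x> = <u,x'> = l even, for distinct primitive x, x'.
   Modulo 2 both x and x' are the nonzero vector orthogonal to u, so x - x' is a
   nonzero even multiple of u rotated by a quarter turn, and |x - x'| >= 2|u|.
   As <u,x + x'> = 2l <> 0, the parallelogram law gives
   2|u|^2 < |x|^2 + |x'|^2. The statement is self-dual.
   In an l-reflexive polygon, take a vertex v of maximal norm, which is
   automatically exposed, and let u, u' be the normals of the two edges at v. The
   inequality along each of these edges gives |u|, |u'| < |v|, whereas the dual
   inequality at v gives 2|v|^2 < |u|^2 + |u'|^2. *)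
Require Import Defs.
From mathcomp Require Import all_boot all_order all_algebra.
From mathcomp Require Import all_classical topology.
From mathcomp Require Import ring lra zify.

Set Implicit Arguments.
Unset Strict Implicit.
Unset Printing Implicit Defensive.

Import Order.TTheory GRing.Theory Num.Theory.

Local Open Scope ring_scope.

(** * The norm inequality in integer coordinates *)

Lemma sumsq_gt0 (R : realDomainType) (a b : R) :
  (0 < a ^+ 2 + b ^+ 2) = (a != 0) || (b != 0).
Proof.
rewrite lt_neqAle addr_ge0 ?sqr_ge0 // andbT eq_sym paddr_eq0 ?sqr_ge0 //.
by rewrite !sqrf_eq0 negb_and.
Qed.

(** Solutions of [a * x + b * y = l] are [l * (r, t) + c * (-b, a)] with [(r, t)] a Bezout pair.
    Coprimality and evenness of [l] force [c] odd, so two solutions differ by an even multiple of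
    [(-b, a)]; the parallelogram law concludes. Bare coordinates let the lemma serve both for points
    and for normals. *)
Lemma normal_norm_lt (l a b p q p' q' : int) :
  0 < l -> (2 %| l)%Z -> coprimez a b -> coprimez p q -> coprimez p' q' ->
  a * p + b * q = l -> a * p' + b * q' = l -> (p, q) <> (p', q') ->
  2 * (a ^+ 2 + b ^+ 2) < (p ^+ 2 + q ^+ 2) + (p' ^+ 2 + q' ^+ 2).
Proof.
move=> l0 /dvdzP[m lE] /coprimezP[[r t] /= rt1] cpq cpq' el el' neq.
have coord x y : coprimez x y -> a * x + b * y = l -> exists k : int,
    [/\ x = l * r - b * (2 * k + 1) & y = l * t + a * (2 * k + 1)].
  move=> /coprimezP[[f g] /= fg1] exy.
  pose c := r * y - t * x.
  have xE : x = l * r - b * c.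
    by rewrite -[LHS]mul1r -rt1 -exy /c; ring.
  have yE : y = l * t + a * c.
    by rewrite -[LHS]mul1r -rt1 -exy /c; ring.
  have [k cE] : exists k, c = 2 * k \/ c = 2 * k + 1.
    by exists (c %/ 2)%Z; lia.
  case: cE => cE; exists k; last by rewrite -cE.
  (* If [c] were even, 2 would divide both coordinates, against the Bezout relation [fg1]. *)
  have : 2 * (f * (m * r - b * k) + g * (m * t + a * k)) = 1.
    by rewrite -[RHS]fg1 xE yE lE cE; ring.
  lia.
have [k [pE qE]] := coord _ _ cpq el.
have [k' [pE' qE']] := coord _ _ cpq' el'.
have kk' : 1 <= (k - k') ^+ 2.
  have : k <> k' by move=> ekk; apply: neq; rewrite pE qE pE' qE' ekk.
  by move/eqP; rewrite -gtz0_ge1 exprn_even_gt0 //= subr_eq0.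
have dist : (p - p') ^+ 2 + (q - q') ^+ 2 = 4 * (k - k') ^+ 2 * (a ^+ 2 + b ^+ 2).
  by rewrite pE qE pE' qE'; ring.
(* Source of strictness: the sum of the two points pairs with [(a, b)] to [2 * l], so it is
   nonzero. *)
have sum_gt0 : 0 < (p + p') ^+ 2 + (q + q') ^+ 2.
  rewrite sumsq_gt0 -negb_and; apply/negP => /andP[/eqP sp /eqP sq].
  have el2 : l + l = a * (p + p') + b * (q + q') by rewrite -{1}el -el'; ring.
  by move: l0; rewrite -(pmulrn_lgt0 l (isT : 0 < 2)%N) mulr2n el2 sp sq !mulr0.
have ab0 : 0 <= a ^+ 2 + b ^+ 2 by rewrite addr_ge0 ?sqr_ge0.
rewrite -(ltr_pM2l (isT : 0 < 2 :> int)).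
have -> : 2 * (p ^+ 2 + q ^+ 2 + (p' ^+ 2 + q' ^+ 2)) =
    (p - p') ^+ 2 + (q - q') ^+ 2 + ((p + p') ^+ 2 + (q + q') ^+ 2) by ring.
rewrite dist ltr_pwDr // mulrA ler_wpM2r //.
by rewrite (ler_pM2l (isT : 0 < 4 :> int) 1).
Qed.

(** * Primitive vectors and coprime coordinates *)

(** The point [y], being [x] divided by [d], lies on the segment from 0 to [x], so it is an
    endpoint. *)
Lemma primitive_scale (m n : nat) (x y : 'M[int]_(m, n)) (d : int) :
  primitive x -> 0 < d -> x = d *: y -> d = 1.
Proof.
move=> [x0 xP] d0 xE.
have d0' : (d%:~R : rat) != 0 by rewrite intr_eq0 gt_eqF.
have [] := xP y.
- exists (d%:~R^-1); split.
    by rewrite invr_ge0 ler0z (ltW d0) invf_le1 ?ltr0z // ler1z.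
  by apply/matrixP => i j; rewrite xE !mxE intrM mulKf.
- by move=> y0; move: x0; rewrite xE y0 scaler0 eqxx.
move=> yx; move: xE; rewrite yx => /eqP.
rewrite -subr_eq0 -{1}[x]scale1r -scalerBl => /eqP/matrixP xE.
have /eqP : (1 - d) *: x = 0 by apply/matrixP => i j; rewrite xE.
case: (eqVneq d 1) => // dn1 e; exfalso; move: e; apply/negP.
apply: contra x0 => /eqP/matrixP e; apply/eqP/matrixP => i j.
have := e i j; rewrite !mxE => /eqP; rewrite mulf_eq0 subr_eq0 eq_sym (negbTE dn1).
by move/eqP.
Qed.

(** The two listed positions exhaust the matrix, so their gcd can be factored out of it. This shape
    covers rows and columns of length 2 at once. *)
Lemma primitive_gcd (m n : nat) (x : 'M[int]_(m, n)) (i i' : 'I_m) (j j' : 'I_n) :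
  primitive x -> (forall k h, (k, h) = (i, j) \/ (k, h) = (i', j')) ->
  coprimez (x i j) (x i' j').
Proof.
move=> xP all2; apply/eqP; set d := gcdz _ _.
have dx k h : (d %| x k h)%Z.
  by case: (all2 k h) => -[-> ->]; rewrite ?dvdz_gcdl ?dvdz_gcdr.
have xE : x = d *: \matrix_(k, h) (x k h %/ d)%Z.
  by apply/matrixP => k h; rewrite !mxE mulrC divzK.
apply: (primitive_scale xP) xE.
rewrite lt_neqAle eq_sym gcdz_eq0 andbT.
apply: contra xP.1 => /andP[/eqP a /eqP b]; apply/eqP/matrixP => k h; rewrite mxE.
by case: (all2 k h) => -[-> ->].
Qed.

(** * Convex hulls and linear functionals *)

Lemma interior_ray (n : nat) (P : set 'rV[rat]_n) (d : 'rV[rat]_n) :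
  origin_in_interior P -> exists2 e : rat, 0 < e & P (e *: d).
Proof.
rewrite /origin_in_interior /interior /= => /nbhs_ballP[e /= e0 eP].
(* Balls are for the sup norm, and [c] strictly exceeds every [|d 0 j|]. *)
pose c := 1 + \sum_j `|d 0 j|.
have c0 : 0 < c by rewrite ltr_pwDl ?sumr_ge0.
have ec0 : 0 < e / c by rewrite divr_gt0.
exists (e / c) => //; apply: eP; split=> // i j.
rewrite /ball /= mxE [(_ *: _ : 'rV[rat]_n) _ _]mxE sub0r normrN normrM gtr0_norm //.
rewrite mulrAC ltr_pdivrMr // ltr_pM2l // ord1 /c (bigD1 j) //=.
by rewrite addrCA ltrDl ltr_pwDl ?sumr_ge0.
Qed.

Lemma pairing_comb (n : nat) (I : Type) (r : seq I) (a : I -> rat)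
    (F : I -> 'rV[rat]_n) (u : 'cV[rat]_n) :
  pairing u (\sum_(i <- r) a i *: F i) = \sum_(i <- r) a i * pairing u (F i).
Proof.
rewrite /pairing mulmx_suml summxE; apply: eq_bigr => i _.
by rewrite -scalemxAl mxE.
Qed.

Lemma pairing_axpy (n : nat) (A B : 'cV[rat]_n) (t : rat) (p : 'rV[rat]_n) :
  pairing (A + t *: B) p = pairing A p + t * pairing B p.
Proof. by rewrite /pairing mulmxDr -scalemxAr !mxE. Qed.

Lemma pairing_rV2 (u : 'cV[rat]_2) (x : 'rV[rat]_2) :
  pairing u x = x 0 0 * u 0 0 + x 0 1 * u 1 0.
Proof.
rewrite /pairing mxE big_ord_recl big_ord1 (_ : lift _ _ = 1) //.
exact: val_inj.
Qed.

Lemma rV2_eq (x y : 'rV[rat]_2) : x 0 0 = y 0 0 -> x 0 1 = y 0 1 -> x = y.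
Proof.
move=> e0 e1; apply/rowP => i; case: (unliftP 0 i) => [j|] -> //.
by rewrite (_ : lift _ _ = 1) //; apply/val_inj; rewrite /= ord1.
Qed.

Lemma conv_hull_mem (n : nat) (s : seq 'rV[rat]_n) (p : 'rV[rat]_n) :
  p \in s -> conv_hull s p.
Proof.
move=> ps; have ip : (index p s < size s)%N by rewrite index_mem.
exists (fun i => (i == Ordinal ip)%:R); split=> [i||]; first exact: ler0n.
  by rewrite (bigD1 (Ordinal ip)) //= eqxx big1 ?addr0 // => i /negbTE ->.
rewrite (bigD1 (Ordinal ip)) //= eqxx scale1r nth_index // big1 ?addr0 // => i.
by move=> /negbTE ->; rewrite scale0r.
Qed.

Lemma conv_hull_le (n : nat) (s : seq 'rV[rat]_n) (u : 'cV[rat]_n) (c : rat)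
    (x : 'rV[rat]_n) :
  (forall p, p \in s -> pairing u p <= c) -> conv_hull s x -> pairing u x <= c.
Proof.
move=> sc [a [a0 a1 ->]]; rewrite pairing_comb -[leRHS]mul1r -a1 mulr_suml.
by apply: ler_sum => i _; rewrite ler_wpM2l ?sc ?mem_nth.
Qed.

(** In a convex combination attaining [c], the nonnegative weighted deficits sum to 0, so only
    entries equal to [v] carry weight. *)
Lemma conv_hull_vertex (n : nat) (s : seq 'rV[rat]_n) (u : 'cV[rat]_n) (c : rat)
    (v : 'rV[rat]_n) :
  v \in s -> pairing u v = c ->
  (forall p, p \in s -> p != v -> pairing u p < c) -> vertex (conv_hull s) v.
Proof.
move=> vs uv sc.
have sc' p : p \in s -> pairing u p <= c.
  by move=> ps; have [->|pv] := eqVneq p v; [rewrite uv | exact/ltW/sc].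
exists u, c; split; first by move=> x; apply: conv_hull_le.
apply/seteqP; split=> [_ ->|x [[a [a0 a1 xE]] xc]].
  by split=> //; apply: conv_hull_mem.
rewrite /= xE -[v]scale1r -a1 scaler_suml; apply: eq_bigr => i _.
have F0 j : 0 <= a j * (c - pairing u s`_j).
  by rewrite mulr_ge0 // subr_ge0 sc' ?mem_nth.
have : \sum_j a j * (c - pairing u s`_j) == 0.
  under eq_bigr do rewrite mulrBr.
  by rewrite sumrB -pairing_comb -xE xc -mulr_suml a1 mul1r subrr.
rewrite psumr_eq0 // => /allP/(_ i); rewrite mem_index_enum => /(_ isT) /=.
rewrite mulf_eq0 => /orP[/eqP ->|]; first by rewrite !scale0r.
have [-> //|iv] := eqVneq s`_i v.
by rewrite subr_eq0 gt_eqF // sc ?mem_nth.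
Qed.

(** * Extremal choices in a finite list and rotation of a supporting line *)

Lemma seq_argmax (T : eqType) (s : seq T) (f : T -> rat) (x : T) : x \in s ->
  exists2 y, y \in s & forall z, z \in s -> f z <= f y.
Proof.
elim: s x => // a s IH x _; case: s IH => [_|b s IH].
  by exists a; rewrite ?mem_head // => z; rewrite inE => /eqP ->.
have [y ys yP] := IH b (mem_head _ _).
have [ay|ya] := leP (f a) (f y).
  exists y; first by rewrite inE ys orbT.
  by move=> z; rewrite inE => /predU1P[->|/yP].
exists a; first by rewrite mem_head.
by move=> z; rewrite inE => /predU1P[->//|/yP /le_trans]; apply; apply: ltW.
Qed.

(** Used to tilt a functional slightly while finitely many strict inequalities survive. *)
Lemma seq_perturb (T : eqType) (s : seq T) (g h : T -> rat) :
  (forall p, p \in s -> 0 < g p) ->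
  exists2 e : rat, 0 < e & forall p, p \in s -> e * h p < g p.
Proof.
elim: s => [|a s IH] gs; first by exists 1.
have [p ps|e e0 eP] := IH; first by apply: gs; rewrite inE ps orbT.
have ga : 0 < g a by apply: gs; rewrite mem_head.
pose d := g a / (1 + `|h a|).
have d1 : 0 < 1 + `|h a| by rewrite ltr_pwDl.
have d0 : 0 < d by rewrite divr_gt0.
have m0 : 0 < Num.min e d by rewrite lt_min e0.
exists (Num.min e d) => // p; rewrite inE => /predU1P[->|ps].
  have [h0|h0] := leP (h a) 0.
    by apply: le_lt_trans ga; rewrite pmulr_rle0.
  apply: (@le_lt_trans _ _ (d * h a)); first by rewrite ler_pM2r // ge_min lexx orbT.
  by rewrite /d mulrAC ltr_pdivrMr // ltr_pM2l // gtr0_norm // ltrDr.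
have [h0|h0] := leP (h p) 0.
  by apply: (@le_lt_trans _ _ 0); [rewrite pmulr_rle0 | apply: gs; rewrite inE ps orbT].
by apply: le_lt_trans (eP p ps); rewrite ler_pM2r // ge_min lexx.
Qed.

(* Rotating the line [A = 1] around a point v with [A v = 1], [B v = 0]
   until it meets s again; w is the last point met on this line. *)
Lemma rotate_to_edge (n : nat) (s : seq 'rV[rat]_n) (A B : 'cV[rat]_n)
    (p0 : 'rV[rat]_n) :
  (forall p, p \in s -> pairing A p <= 1) ->
  (forall p, p \in s -> pairing B p != 0 -> pairing A p < 1) ->
  p0 \in s -> 0 < pairing B p0 ->
  (forall p q, p \in s -> q \in s -> pairing A p = pairing A q ->
     pairing B p = pairing B q -> p = q) ->
  exists t w, [/\ 0 < t, w \in s, 0 < pairing B w /\ pairing (A + t *: B) w = 1,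
    forall p, p \in s -> pairing (A + t *: B) p <= 1 & vertex (conv_hull s) w].
Proof.
move=> As AsB p0s Bp0 inj.
(* [- f p] is the value of [t] at which the rotating line reaches [p]; maximizing [f] finds the
   first point met. *)
pose f p := - ((1 - pairing A p) / pairing B p).
have : p0 \in [seq p <- s | 0 < pairing B p] by rewrite mem_filter Bp0.
move=> /(seq_argmax f)[q].
rewrite mem_filter => /andP[Bq qs] qP.
set t := - f q.
have t0 : 0 < t by rewrite /t /f opprK divr_gt0 // subr_gt0 AsB // gt_eqF.
have sle p : p \in s -> pairing (A + t *: B) p <= 1.
  move=> ps; rewrite pairing_axpy; have [B0|B0] := leP (pairing B p) 0.
    by rewrite -[leRHS]addr0 lerD ?As // pmulr_rle0.
  have := qP p; rewrite mem_filter B0 ps => /(_ isT).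
  by rewrite /f lerNl -/(f q) -/t ler_pdivlMr // lerBrDl.
have tq : pairing (A + t *: B) q = 1.
  by rewrite pairing_axpy /t /f opprK divfK ?gt_eqF // addrC subrK.
(* [q] may lie inside the edge; the far end [w] maximizes [B] on the line. *)
have : q \in [seq p <- s | pairing (A + t *: B) p == 1].
  by rewrite mem_filter tq eqxx.
move=> /(seq_argmax (pairing B))[w].
rewrite mem_filter => /andP[/eqP tw ws] wP.
have Bw : 0 < pairing B w.
  by apply: (lt_le_trans Bq); apply: wP; rewrite mem_filter tq eqxx.
exists t, w; split=> //.
(* A further tilt by a small [e] makes [w] the unique maximizer over [s], hence a vertex. *)
have [e e0 eP] : exists2 e : rat, 0 < e &
    forall p, p \in [seq p <- s | pairing (A + t *: B) p != 1] ->
    e * (pairing B p - pairing B w) < 1 - pairing (A + t *: B) p.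
  apply: seq_perturb => p; rewrite mem_filter => /andP[p1 ps].
  by rewrite subr_gt0 lt_neqAle p1 sle.
apply: (@conv_hull_vertex _ _ (A + (t + e) *: B) (1 + e * pairing B w)) => //.
  by rewrite pairing_axpy mulrDl addrA -pairing_axpy tw.
move=> p ps pw; rewrite pairing_axpy mulrDl addrA -pairing_axpy.
have [p1|p1] := eqVneq (pairing (A + t *: B) p) 1.
  rewrite p1 ltrD2l ltr_pM2l // lt_neqAle wP ?mem_filter ?p1 ?eqxx // andbT.
  apply: contra pw => /eqP Bpw; apply/eqP/inj => //.
  by move: p1; rewrite -tw !pairing_axpy Bpw => /addIr.
have := eP p; rewrite mem_filter p1 ps => /(_ isT).
rewrite mulrBr; lra.
Qed.

(** * Edges of a plane polygon *)

(** The points [v] and [w] give dimension at least 1. It is no more, since [u] is nonzero by [0 < c]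
    and all differences along the line are multiples of [(-b, a)]. *)
Lemma line_facet (P : set 'rV[rat]_2) (u : 'cV[rat]_2) (c : rat) (v w : 'rV[rat]_2) :
  has_dim P 2 -> (forall x, P x -> pairing u x <= c) -> 0 < c ->
  P v -> P w -> pairing u v = c -> pairing u w = c -> v != w ->
  facet P [set x | P x /\ pairing u x = c]%classic.
Proof.
move=> P2 Pc c0 Pv Pw uv uw vw; exists 1%N; split=> //; first by exists u, c.
split.
  exists [tuple v; w]; split; last by rewrite /aff_indep /= seq1_free subr_eq0 eq_sym.
  by move=> i; rewrite (tnth_nth 0); case: i => -[|[|i]].
move=> [p [pF]].
have [] := (pF 0, pF 1, pF (lift 0 1)).
rewrite /aff_indep; case: p pF => -[|x [|y [|z []]]] //= sz pF.
rewrite !(tnth_nth 0) /= => -[] [_ ux] [_ uy] [_ uz].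
rewrite free_cons seq1_free span_seq1 => /andP[/vlineP nyz zx]; apply: nyz.
move: ux uy uz; rewrite !pairing_rV2.
set a := u 0 0; set b := u 1 0 => ux uy uz.
have ab : 0 < a ^+ 2 + b ^+ 2.
  rewrite sumsq_gt0 -negb_and; apply/negP => /andP[/eqP a0 /eqP b0].
  by move: c0; rewrite -ux a0 b0 !mulr0 addr0 ltxx.
have para d : d 0 0 * a + d 0 1 * b = 0 -> exists k : rat,
    d 0 0 = - (k * b) /\ d 0 1 = k * a :> rat.
  (* The coefficient of the orthogonal projection of [d] onto [(-b, a)]. *)
  move=> d0; exists ((d 0 1 * a - d 0 0 * b) / (a ^+ 2 + b ^+ 2)); split.
    apply: (mulIf (lt0r_neq0 ab)); rewrite mulNr mulrAC divfK ?lt0r_neq0 //.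
    apply/eqP; rewrite -subr_eq0; apply/eqP.
    by transitivity (a * (d 0 0 * a + d 0 1 * b)); [ring | rewrite d0 mulr0].
  apply: (mulIf (lt0r_neq0 ab)); rewrite mulrAC divfK ?lt0r_neq0 //.
  apply/eqP; rewrite -subr_eq0; apply/eqP.
  by transitivity (b * (d 0 0 * a + d 0 1 * b)); [ring | rewrite d0 mulr0].
have [k [y0 y1]] : exists k : rat, (y - x) 0 0 = - (k * b) /\ (y - x) 0 1 = k * a.
  by apply: para; rewrite !mxE; lra.
have [h [z0 z1]] : exists k : rat, (z - x) 0 0 = - (k * b) /\ (z - x) 0 1 = k * a.
  by apply: para; rewrite !mxE; lra.
have h0 : h != 0.
  by apply: contra zx => /eqP h0; apply/eqP/rV2_eq; rewrite ?z0 ?z1 h0 mxE mul0r ?oppr0.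
exists (k / h); apply: rV2_eq; rewrite [RHS]mxE ?y0 ?y1 ?z0 ?z1.
  by rewrite mulrN mulrA divfK.
by rewrite mulrA divfK.
Qed.

(** Otherwise [u] would be nonpositive on the hull, which contains a positive multiple of [u^T]. *)
Lemma interior_pairing_gt0 (s : seq 'rV[rat]_2) (u : 'cV[rat]_2) :
  origin_in_interior (conv_hull s) -> u != 0 -> exists2 p, p \in s & 0 < pairing u p.
Proof.
move=> s0 u0; have [/hasP[p]|/hasPn sle] := boolP (has (fun p => 0 < pairing u p) s).
  by exists p.
have [e e0 se] := interior_ray u^T s0.
have : pairing u (e *: u^T) <= 0.
  by apply: conv_hull_le se => p /sle; rewrite -leNgt.
rewrite pairing_rV2 !mxE -!mulrA -mulrDr pmulr_rle0 // leNgt -!expr2 sumsq_gt0.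
rewrite -negb_and negbK => /andP[/eqP a0 /eqP b0].
by case/eqP: u0; apply: trmx_inj; apply: rV2_eq; rewrite !mxE.
Qed.

(** * Lattice coordinates and the edges at a longest vertex *)

Lemma primitive_row (x : 'rV[int]_2) : primitive x -> coprimez (x 0 0) (x 0 1).
Proof.
move/primitive_gcd; apply=> k h; rewrite (ord1 k).
case: (unliftP 0 h) => [j|] ->; [right | by left].
by rewrite (ord1 j); congr (_, _); apply: val_inj.
Qed.

Lemma primitive_col (u : 'cV[int]_2) : primitive u -> coprimez (u 0 0) (u 1 0).
Proof.
move/primitive_gcd; apply=> h k; rewrite (ord1 k).
case: (unliftP 0 h) => [j|] ->; [right | by left].
by rewrite (ord1 j); congr (_, _); apply: val_inj.
Qed.

Lemma pairing_lat_emb (u : 'cV[int]_2) (x : 'rV[int]_2) :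
  pairing (lat_emb u) (lat_emb x) = (u 0 0 * x 0 0 + u 1 0 * x 0 1)%:~R.
Proof. by rewrite pairing_rV2 !mxE rmorphD !rmorphM /= mulrC [X in _ + X]mulrC. Qed.

(* [eps] selects on which side of the line through 0 and the longest vertex x
   the edge lies. *)
Lemma edge_at_longest_vertex (l : nat) (s : seq 'rV[rat]_2) (x : 'rV[int]_2)
    (eps : rat) :
  (0 < l)%N -> ~~ odd l -> reflexive_polygon l (conv_hull s) ->
  lat_emb x \in s -> primitive x ->
  (forall p, p \in s ->
    p 0 0 ^+ 2 + p 0 1 ^+ 2 <= (x 0 0 ^+ 2 + x 0 1 ^+ 2)%:~R) ->
  eps != 0 ->
  exists u : 'cV[int]_2,
    [/\ primitive u, u 0 0 * x 0 0 + u 1 0 * x 0 1 = l,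
        u 0 0 ^+ 2 + u 1 0 ^+ 2 < x 0 0 ^+ 2 + x 0 1 ^+ 2,
        (exists w, [/\ conv_hull s w, pairing (lat_emb u) w = l%:R &
           0 < eps * (w 0 1 * (x 0 0)%:~R - w 0 0 * (x 0 1)%:~R)]) &
        forall p, conv_hull s p -> pairing (lat_emb u) p = l%:R ->
          0 <= eps * (p 0 1 * (x 0 0)%:~R - p 0 0 * (x 0 1)%:~R)].
Proof.
move=> l0 lev [[_ P2 Pvert] P0 Pprim Pfac] xs xprim xmax eps0.
have lZ : (2 %| l%:Z)%Z by rewrite dvdzE /= dvdn2.
set v := lat_emb x in xs.
set N : rat := (_ + _)%:~R in xmax.
(* The line [A = 1] is the tangent at [v] to the circle through [v] centred at 0; [B] is [v] rotated
   by a quarter turn. *)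
pose A : 'cV[rat]_2 := N^-1 *: v^T.
pose B : 'cV[rat]_2 := \col_i (if i == 0 then - v 0 1 else v 0 0).
have NE : N = v 0 0 ^+ 2 + v 0 1 ^+ 2 by rewrite /N rmorphD !rmorphXn /= !mxE.
have BE p : pairing B p = p 0 1 * v 0 0 - p 0 0 * v 0 1.
  by rewrite pairing_rV2 !mxE /= mulrN addrC.
have AE p : pairing A p = (p 0 0 * v 0 0 + p 0 1 * v 0 1) / N.
  rewrite pairing_rV2 !mxE; ring.
have N0 : 0 < N.
  rewrite NE sumsq_gt0 -negb_and; apply: contra xprim.1.
  rewrite !mxE !intr_eq0 => /andP[/eqP a0 /eqP b0].
  apply/eqP/rowP => i; rewrite mxE.
  case: (unliftP 0 i) => [j|] -> //; rewrite (ord1 j) -b0; congr (x _ _).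
  exact: val_inj.
have B0 : B != 0.
  apply: contraTN N0 => /eqP B0; rewrite NE !mxE.
  have /matrixP/(_ 0 0) := B0; have /matrixP/(_ 1 0) := B0; rewrite !mxE /=.
  by move=> -> /eqP; rewrite oppr_eq0 => /eqP ->; rewrite !expr0n addr0 ltxx.
have sB p : pairing (eps *: B) p = eps * pairing B p.
  by rewrite /pairing -scalemxAr mxE.
have vA : pairing A v = 1 by rewrite AE -!expr2 -NE divff ?gt_eqF.
have vB : pairing B v = 0 by rewrite BE mulrC subrr.
(* Pythagoras in the orthogonal frame of [v]: points of the disc satisfy [A <= 1], with equality
   only where [B] vanishes. *)
have gram p : (pairing A p * N) ^+ 2 + pairing B p ^+ 2 =
    (p 0 0 ^+ 2 + p 0 1 ^+ 2) * N.
  by rewrite AE BE divfK ?gt_eqF // NE; ring.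
have As p : p \in s -> (pairing A p * N) ^+ 2 + pairing B p ^+ 2 <= N ^+ 2.
  by move=> ps; rewrite gram expr2 ler_pM2r // xmax.
have Ale p : p \in s -> pairing A p <= 1.
  move=> /As ps; rewrite -(ler_pM2r N0) mul1r leNgt; apply/negP => lt.
  have : N ^+ 2 < (pairing A p * N) ^+ 2 by rewrite ltr_sqr ?nnegrE; lra.
  by have := sqr_ge0 (pairing B p); lra.
have [p0 p0s Bp0] : exists2 p, p \in s & 0 < pairing (eps *: B) p.
  by apply: interior_pairing_gt0 => //; rewrite scaler_eq0 negb_or eps0.
have [||||p q _ _|t [w [t0 ws [Bw tw] tle wv]]] := @rotate_to_edge 2 s A (eps *: B) p0.
- exact: Ale.
- move=> p /As ps; rewrite sB mulf_eq0 negb_or eps0 /= => Bp.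
  rewrite -(ltr_pM2r N0) mul1r ltNge; apply/negP => le.
  have : N ^+ 2 <= (pairing A p * N) ^+ 2 by rewrite ler_sqr ?nnegrE; lra.
  have : 0 < pairing B p ^+ 2 by rewrite exprn_even_gt0.
  by lra.
- exact: p0s.
- exact: Bp0.
(* [A] and [B] are coordinates in this frame, so they determine the point. *)
- move=> eA; rewrite !sB => /(mulfI eps0) eB.
  have cx (r : 'rV[rat]_2) : r 0 0 * N = (pairing A r * N) * v 0 0 - pairing B r * v 0 1.
    by rewrite AE BE divfK ?gt_eqF // NE; ring.
  have cy (r : 'rV[rat]_2) : r 0 1 * N = (pairing A r * N) * v 0 1 + pairing B r * v 0 0.
    by rewrite AE BE divfK ?gt_eqF // NE; ring.
  by apply: rV2_eq; apply: (mulIf (lt0r_neq0 N0)); rewrite ?cx ?cy eA eB.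
have [y yE] := Pvert w wv.
have yprim : primitive y by apply: Pprim; rewrite -yE.
have vw : v != w by apply: contraTneq Bw => <-; rewrite sB vB mulr0 ltxx.
have [Pv Pw] := (conv_hull_mem xs, conv_hull_mem ws).
have tv : pairing (A + t *: (eps *: B)) v = 1.
  by rewrite pairing_axpy sB vA vB !mulr0 addr0.
have tle' p : conv_hull s p -> pairing (A + t *: (eps *: B)) p <= 1.
  exact: conv_hull_le.
have /Pfac[u [uprim _ uF]] := line_facet P2 tle' ltr01 Pv Pw tv tw vw.
(* Both functionals cut out the same edge; agreement on the hull is enough below. *)
have uE p : conv_hull s p ->
    pairing (lat_emb u) p = l%:R <-> pairing (A + t *: (eps *: B)) p = 1.
  move=> Pp; split=> e.
    have : [set q | conv_hull s q /\ pairing (lat_emb u) q = l%:R]%classic p by [].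
    by rewrite -uF => -[].
  have : [set q | conv_hull s q /\ pairing (A + t *: (eps *: B)) q = 1]%classic p by [].
  by rewrite uF => -[].
have ux : u 0 0 * x 0 0 + u 1 0 * x 0 1 = l.
  by apply: (@intr_inj rat); rewrite -pairing_lat_emb; apply/uE.
have uy : u 0 0 * y 0 0 + u 1 0 * y 0 1 = l.
  by apply: (@intr_inj rat); rewrite -pairing_lat_emb -yE; apply/uE.
have DE (p : 'rV[rat]_2) : p 0 1 * (x 0 0)%:~R - p 0 0 * (x 0 1)%:~R = pairing B p.
  by rewrite BE !mxE.
exists u; split=> //.
(* The other end [y] of the edge is no longer than [x], so the norm inequality for [x] and [y]
   bounds [u] by [x] alone. *)
- have yx : y 0 0 ^+ 2 + y 0 1 ^+ 2 <= x 0 0 ^+ 2 + x 0 1 ^+ 2.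
    by rewrite -(ler_int rat) rmorphD !rmorphXn /=; have := xmax w ws; rewrite yE !mxE.
  have : 2 * (u 0 0 ^+ 2 + u 1 0 ^+ 2) <
      x 0 0 ^+ 2 + x 0 1 ^+ 2 + (y 0 0 ^+ 2 + y 0 1 ^+ 2).
    apply: (normal_norm_lt (l := l)) => //; [exact: primitive_col
      | exact: primitive_row | exact: primitive_row | move=> [xy0 xy1]].
    by case/eqP: vw; rewrite yE; apply: rV2_eq; rewrite !mxE ?xy0 ?xy1.
  move=> lt; rewrite -(ltr_pM2l (isT : 0 < 2 :> int)).
  by apply: lt_le_trans lt _; rewrite mulr_natl mulr2n lerD2l.
- by exists w; rewrite DE -sB; split=> //; apply/uE.
(* On the edge, [t * (eps * B p) = 1 - A p], which is nonnegative. *)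
- move=> p Pp /(uE p Pp); rewrite pairing_axpy sB DE => e.
  have := conv_hull_le Ale Pp; rewrite -(pmulr_rge0 _ t0); lra.
Qed.

(** * Contradiction at a longest vertex *)

Theorem proposition1p3 (l : nat) (hl : (0 < l)%N) (hev : ~~ odd l) :
  ~ exists P : set 'rV[rat]_2, reflexive_polygon l P.
Proof.
move=> [P Pl]; have [[[s PE] _ Pvert] P0 Pprim _] := Pl; subst P.
pose f (p : 'rV[rat]_2) := p 0 0 ^+ 2 + p 0 1 ^+ 2.
have e0 : (delta_mx 0 0 : 'cV[rat]_2) != 0.
  by apply/eqP => /matrixP/(_ 0 0); rewrite !mxE.
have [p ps _] := interior_pairing_gt0 P0 e0.
have [v vs vmax] := seq_argmax f ps.
have vvert : vertex (conv_hull s) v.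
  apply: (@conv_hull_vertex _ _ v^T (f v)) => // [|q qs qv].
    by rewrite pairing_rV2 !mxE -!expr2.
  (* Expanding this square with [f q <= f v] shows that [v], taken as a functional, is strictly
     smaller at [q] than at [v]. *)
  have : 0 < (q 0 0 - v 0 0) ^+ 2 + (q 0 1 - v 0 1) ^+ 2.
    rewrite sumsq_gt0 !subr_eq0 -negb_and; apply: contra qv => /andP[/eqP a /eqP b].
    exact/eqP/rV2_eq.
  have := vmax q qs; rewrite pairing_rV2 !mxE /f; lra.
have [x xE] := Pvert v vvert; subst v.
have xprim := Pprim x vvert.
have xmax q : q \in s -> f q <= (x 0 0 ^+ 2 + x 0 1 ^+ 2)%:~R.
  by move=> /vmax; rewrite /f !mxE rmorphD !rmorphXn.
have [u [uprim ux ulen [w [Pw uw Bw]] _]] :=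
  edge_at_longest_vertex hl hev Pl vs xprim xmax (oner_neq0 rat).
have m1 : (- 1 : rat) != 0 by rewrite oppr_eq0 oner_neq0.
have [u' [uprim' ux' ulen' _ uside]] :=
  edge_at_longest_vertex hl hev Pl vs xprim xmax m1.
(* The point [w] of the first edge is strictly on one side of the line through 0 and [x], and the
   second edge never enters that side. *)
have uu' : (u 0 0, u 1 0) <> (u' 0 0, u' 1 0).
  move=> [e1 e2]; have eu : lat_emb u = lat_emb u'.
    by apply: trmx_inj; apply: rV2_eq; rewrite !mxE ?e1 ?e2.
  have := uside w Pw; rewrite -eu => /(_ uw); lra.
(* The dual use: [x] acts as the normal, [u] and [u'] as the two points. *)
have : 2 * (x 0 0 ^+ 2 + x 0 1 ^+ 2) <
    u 0 0 ^+ 2 + u 1 0 ^+ 2 + (u' 0 0 ^+ 2 + u' 1 0 ^+ 2).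
  apply: (normal_norm_lt (l := l)) => //; try exact: primitive_col.
  - by rewrite dvdzE /= dvdn2.
  - exact: primitive_row.
  - by rewrite -ux [x 0 0 * _]mulrC [x 0 1 * _]mulrC.
  - by rewrite -ux' [x 0 0 * _]mulrC [x 0 1 * _]mulrC.
by rewrite mulr_natl mulr2n ltNge (ltW (ltrD ulen ulen')).
Qed.
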